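(* Each barycentric coordinate $\mu^k_j$ computed by the double-description algorithm (defined in the context) is a constraint product ratio. If the number of executions of Case 2 of the algorithm is $i$, then the degree of the numerator (resp. denominator) of the barycentric coordinate is bounded from above by $\frac{3^i}{2}+\frac12$ (resp. $\frac{3^i}{2}-\frac12$).
   Context: A constraint expression is any linear expression whose non-negativity is one of the constraints defining $K=\{(x_0;x)\in\mathbb R^{n+1}\mid\bar A(x_0;x)\ge0,\ x_0\ge0\}$, where $\bar A\in\mathbb R^{m\times(n+1)}$. A function is a constraint product ratio if it can be expressed as a ratio of two functions, each a non-negative combination of products of constraint expressions. Double-description algorithm. Let $\bar A_{1,:},\dots,\bar A_{m,:}$ be the rows of $\bar A$. Coordinates of $\mathbb R^{n+1}$ are indexed $0,\dots,n$; points are written $(x_0;x)$; $e_0,\dots,e_n$ are the unit vectors. The algorithm produces matrices $R^k$ ($p_k$ columns, rays) and $L^k$ ($q_k$ columns, lineality directions) with $n+1$ rows, and symbolic expressions in $(x_0;x)$ forming vectors $\mu^k$ (length $p_k$; barycentric coordinates of the rays) and $\theta^k$ (length $q_k$). Initialization: $L^0=(e_1,\dots,e_n)$, $\theta^0=x$, $R^0=(e_0)$, $\mu^0=(x_0)$. Iteration $k=1,\dots,m$: write $L,\theta,R,\mu,p,q$ for $L^{k-1},\theta^{k-1},R^{k-1},\mu^{k-1},p_{k-1},q_{k-1}$, and set $\alpha=\bar A_{k,:}L$, $\beta=\bar A_{k,:}R$. Case 1 ($q>0$ and $\alpha\ne0$): let $\xi=\min\{i\mid\alpha_i\neq0\}$;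 if $\alpha_\xi<0$ replace (in place) $L_{:,\xi},\theta_\xi,\alpha_\xi$ by their negatives. Set $\mu^k=\bigl(\theta_\xi+\sum_{j=\xi+1}^{q}\alpha_j\theta_j/\alpha_\xi+\sum_{j=1}^{p}\beta_j\mu_j/\alpha_\xi,\ (\mu_j/\alpha_\xi)_{j=1}^{p}\bigr)$, $\theta^k=\bigl((\theta_j)_{j<\xi},(\theta_j/\alpha_\xi)_{j>\xi}\bigr)$, $R^k=\bigl(L_{:,\xi},(\alpha_\xi R_{:,j}-\beta_jL_{:,\xi})_{j=1}^{p}\bigr)$, $L^k=\bigl((L_{:,j})_{j<\xi},(\alpha_\xi L_{:,j}-\alpha_jL_{:,\xi})_{j>\xi}\bigr)$. Case 2 (otherwise): let $N^-,N^0,N^+$ be the sets of $i$ with $\beta_i<0$, $=0$, $>0$, and $N_{\rm tot}=\sum_{i\in N^+}\mu_i\beta_i$. Set $\mu^k=\bigl(\mu_{N^0},(\mu_i+\sum_{j\in N^-}\mu_j\mu_i\beta_j/N_{\rm tot})_{i\in N^+},(\mu_j\mu_i/N_{\rm tot})_{i\in N^+,j\in N^-}\bigr)$, $R^k=\bigl(R_{:,N^0},R_{:,N^+},(\beta_iR_{:,j}-\beta_jR_{:,i})_{i\in N^+,j\in N^-}\bigr)$, $\theta^k=\theta$, $L^k=L$. Two-phase execution: rows are ordered so that whenever some not yet processed row is not orthogonal to the current $L^{k-1}$, such a row is processed next; thus all executions of Case 1 precede all executions of Case 2. *)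

(* Defs.v *)
From HB Require Import structures.
From mathcomp Require Import all_boot all_order all_algebra.
From mathcomp Require Export mpoly.

Set Implicit Arguments.
Unset Strict Implicit.
Unset Printing Implicit Defensive.

Import Order.TTheory GRing.Theory Num.Theory.
Local Open Scope ring_scope.

(* Symbolic expressions in (x_0; x) are elements of the field of rational
   functions in the n+1 variables 'X_0, ..., 'X_n over the ordered field R;
   equality of expressions is equality of rational functions. *)
Notation ratfun R n := {fraction {mpoly R[n.+1]}}.

Section DoubleDescription.

Variables (R : realFieldType) (n : nat).

Definition linear_expr (a : 'rV[R]_n.+1) : {mpoly R[n.+1]} :=
  \sum_(i < n.+1) a 0 i *: 'X_i.

Section ConstraintProductRatio.

Variables (m : nat) (A : 'M[R]_(m, n.+1)).

Definition constraint_expr (f : {mpoly R[n.+1]}) : Prop :=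
  f = 'X_ord0 \/ exists i : 'I_m, f = linear_expr (row i A).

(* Each entry of s is a pair (coefficient, list of factors); an empty list of
   factors stands for the product 1. *)
Definition nonneg_comb_products (P : {mpoly R[n.+1]}) : Prop :=
  exists s : seq (R * seq {mpoly R[n.+1]}),
    (forall t, t \in s ->
       0 <= t.1 /\ forall f, f \in t.2 -> constraint_expr f) /\
    P = \sum_(t <- s) t.1 *: \prod_(f <- t.2) f.

Definition constraint_product_repr (f : ratfun R n) (P Q : {mpoly R[n.+1]}) :
    Prop :=
  [/\ nonneg_comb_products P, nonneg_comb_products Q, Q != 0 &
      f = FracField.tofrac P / FracField.tofrac Q].

Definition constraint_product_ratio (f : ratfun R n) : Prop :=
  exists P Q, constraint_product_repr f P Q.

End ConstraintProductRatio.

(* Total degree; [msize P] is the degree plus one, and 0 for P = 0. *)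
Definition total_degree (P : {mpoly R[n.+1]}) : nat := (msize P).-1.

(* A column of the matrix R^k (resp. L^k) together with the corresponding entry
   of mu^k (resp. theta^k); [rays] holds the pairs for R^k and mu^k, [lines]
   those for L^k and theta^k. *)
Definition generator : Type := ('cV[R]_n.+1 * ratfun R n)%type.

Record dd_state := DDState {
  rays : seq generator;
  lines : seq generator
}.

Definition scal (c : R) : ratfun R n := FracField.tofrac c%:MP.

Definition var (i : 'I_n.+1) : ratfun R n := FracField.tofrac 'X_i.

Definition unit_col (i : 'I_n.+1) : 'cV[R]_n.+1 := delta_mx i 0.

(* The value a v; it is alpha_j on the lines and beta_j on the rays. *)
Definition slope (a : 'rV[R]_n.+1) (g : generator) : R := (a *m g.1) 0 0.

Definition dd_init : dd_state :=
  DDState [:: (unit_col ord0, var ord0)]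
          [seq (unit_col (lift ord0 i), var (lift ord0 i)) | i <- enum 'I_n].

Definition is_case1 (a : 'rV[R]_n.+1) (s : dd_state) : bool :=
  has (fun l => slope a l != 0) (lines s).

(* xi is the 0-based index of the pivot line and the default value of [nth] is
   never used, since is_case1 a s holds whenever the step is executed. *)
Definition dd_case1 (a : 'rV[R]_n.+1) (s : dd_state) : dd_state :=
  let xi := find (fun l => slope a l != 0) (lines s) in
  let l0 := nth (0, 0) (lines s) xi in
  let l := if slope a l0 < 0 then (- l0.1, - l0.2) else l0 in
  let alpha := slope a l in
  let before := take xi (lines s) in
  let after := drop xi.+1 (lines s) in
  let mu0 := l.2
    + \sum_(t <- after) scal (slope a t) * t.2 / scal alpha
    + \sum_(r <- rays s) scal (slope a r) * r.2 / scal alpha in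
  let update g := (alpha *: g.1 - slope a g *: l.1, g.2 / scal alpha) in
  DDState ((l.1, mu0) :: map update (rays s)) (before ++ map update after).

(* Ntot only occurs in entries indexed by an element of Npos, in which case it
   is a nonzero rational function. *)
Definition dd_case2 (a : 'rV[R]_n.+1) (s : dd_state) : dd_state :=
  let Nneg := [seq r <- rays s | slope a r < 0] in
  let Nzero := [seq r <- rays s | slope a r == 0] in
  let Npos := [seq r <- rays s | 0 < slope a r] in
  let Ntot := \sum_(i <- Npos) i.2 * scal (slope a i) in
  DDState
    (Nzero
     ++ [seq (i.1, i.2 + \sum_(j <- Nneg) j.2 * i.2 * scal (slope a j) / Ntot)
        | i <- Npos]
     ++ [seq (slope a i *: j.1 - slope a j *: i.1, j.2 * i.2 / Ntot)
        | i <- Npos, j <- Nneg])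
    (lines s).

Definition dd_step (s : dd_state) (a : 'rV[R]_n.+1) : dd_state :=
  if is_case1 a s then dd_case1 a s else dd_case2 a s.

Section Run.

Variables (m : nat) (A : 'M[R]_(m, n.+1)).

(* State after k iterations, i.e. after processing the first k rows of A. *)
Definition dd_run (k : nat) : dd_state :=
  foldl dd_step dd_init (take k [seq row i A | i <- enum 'I_m]).

Definition dd_mu (k : nat) : seq (ratfun R n) := [seq r.2 | r <- rays (dd_run k)].

(* Rows are 0-based: row i is processed in the state [dd_run i]. *)
Definition dd_num_case2 (k : nat) : nat :=
  #|[set i : 'I_m | (i < k)%N && ~~ is_case1 (row i A) (dd_run i)]|.

(* is_case1 (row j A) (dd_run k) says exactly that row j is not orthogonal to
   the current matrix L. *)
Definition two_phase : Prop :=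
  forall k : 'I_m,
    (exists2 j : 'I_m, (k <= j)%N & is_case1 (row j A) (dd_run k)) ->
    is_case1 (row k A) (dd_run k).

End Run.

End DoubleDescription.

(* Main.v *)
Require Import Defs.
From HB Require Import structures.
From mathcomp Require Import all_boot all_order all_algebra.
From mathcomp Require Import ring lra zify.

Set Implicit Arguments.
Unset Strict Implicit.
Unset Printing Implicit Defensive.

Import Order.TTheory GRing.Theory Num.Theory.
Local Open Scope ring_scope.

(** The coordinates are kept over a common denominator.  Call [ratio_over Q D]
    the convex cone of the fractions [P / Q] whose numerator [P] is a
    non-negative combination of products of constraint expressions, of degree at
    most [D].

    As long as only lineality directions are eliminated (Case 1), the generators
    weighted by their coordinates add up to the point [(x_0; x)].  Evaluating the
    processed row [a] on this identity shows that the new coordinate is [a] itself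
    up to a positive factor, while the other coordinates are rescaled; hence
    every coordinate stays a non-negative multiple of a constraint
    ([first_phase_case1]).

    From the first execution of Case 2 on, the remaining rows vanish on the
    lines.  The invariant [common_denominator] then says that, for one [Q] of
    degree less than [D], the cone [ratio_over Q D] contains all the coordinates
    and also the value [S_b = \sum_j (b R_j) mu_j] of every remaining row [b].
    One execution for the row [a] turns [D] into [2 D].  Write
    [N_tot = T / Q].
    - If [T] is nonzero, the sum of the weighted rays does not change, so neither
      do the [S_b].  The coordinates become [mu_i], [mu_i S_a / N_tot] and
      [mu_i mu_j / N_tot], which all have the denominator [Q T]
      ([common_denominator_case2_regular]).
    - If [N_tot = 0], in particular if no ray is on the positive side, the new
      coordinates are old ones or zero, division by zero being zero, but the
      negative rays are lost and [S_b] loses the terms [(b R_j) mu_j] with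
      [a R_j < 0].  Now [S_a] is the sum of the [(a R_i) mu_i] over the lost
      rays, so that [- mu_j] is, up to a positive factor, [S_a] plus non-negative
      multiples of the other [mu_i]: both [mu_j] and [- mu_j] are in the cone,
      and so is the new [S_b] ([common_denominator_case2_degenerate]).

    After [i] executions of Case 2, the numerators thus have degree at most [2 ^ i]
    and the denominators at most [2 ^ i - 1] ([dd_mu_repr]), which is within the
    bounds since [2 * 2 ^ i <= 3 ^ i + 1]. *)

(** * Degrees and constants *)

Local Notation "p %:F" := (FracField.tofrac p).

Lemma mul_div_common (F : fieldType) (p p' q t : F) : q != 0 -> t != 0 ->
  p / q * (p' / q) / (t / q) = p * p' / (q * t).
Proof. by move=> q0 t0; field; rewrite q0 t0. Qed.

Lemma eliminate_pivot (F : fieldType) (al bl ag bg x : F) : al != 0 ->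
  (al * bg - ag * bl) * (x / al) = bg * x - bl / al * (ag * x).
Proof. by move=> al0; field. Qed.

Lemma pivot_coordinate (F : fieldType) (al x r t : F) : al != 0 ->
  x + t / al + r / al = al^-1 * (r + (al * x + t)).
Proof. by move=> al0; field. Qed.

Lemma pivot_identity (F : fieldType) (al bl x ra rb ta tb u : F) : al != 0 ->
  bl * (x + ta / al + ra / al) + (rb - bl / al * ra)
    + (u + (tb - bl / al * ta))
  = rb + (u + (bl * x + tb)).
Proof. by move=> al0; field. Qed.

Section Constants.

Variables (R : realFieldType) (n : nat).
Implicit Types (P Q : {mpoly R[n.+1]}) (c d : R).

Lemma total_degreeD P Q D :
  (total_degree P <= D)%N -> (total_degree Q <= D)%N ->
  (total_degree (P + Q) <= D)%N.
Proof.
rewrite /total_degree -!subn1 !leq_subLR => PD QD.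
by apply: leq_trans (msizeD_le P Q) _; rewrite geq_max PD QD.
Qed.

Lemma total_degreeZ c P : (total_degree (c *: P) <= total_degree P)%N.
Proof. by rewrite /total_degree -!subn1 leq_sub2r // msizeZ_le. Qed.

Lemma total_degreeM P Q :
  (total_degree (P * Q) <= total_degree P + total_degree Q)%N.
Proof.
rewrite /total_degree; have [->|P0] := eqVneq P 0; first by rewrite mul0r msize0.
have [->|Q0] := eqVneq Q 0; first by rewrite mulr0 msize0.
rewrite msizeM //; move: P0 Q0; rewrite -!msize_poly_eq0.
by case: (msize P) (msize Q) => [|p] [|q]; rewrite // addSn addnS.
Qed.

Lemma total_degree1 : total_degree (1 : {mpoly R[n.+1]}) = 0%N.
Proof. by rewrite /total_degree msize1. Qed.

Lemma total_degree_linear_expr (a : 'rV[R]_n.+1) :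
  (total_degree (linear_expr a) <= 1)%N.
Proof.
rewrite /linear_expr; elim/big_ind: _ => [|P Q|i _]; last 1 first.
- apply: leq_trans (total_degreeZ _ _) _.
  by rewrite /total_degree msizeX mdeg1.
- by rewrite /total_degree msize0.
- exact: total_degreeD.
Qed.

Lemma scal0 : scal n (0 : R) = 0.
Proof. by rewrite /scal mpolyC0 rmorph0. Qed.

Lemma scal_eq0 c : (scal n c == 0) = (c == 0).
Proof. by rewrite /scal tofrac_eq0 mpolyC_eq0. Qed.

Lemma scalB c d : scal n (c - d) = scal n c - scal n d.
Proof. by rewrite /scal mpolyCB rmorphB. Qed.

Lemma scalN c : scal n (- c) = - scal n c.
Proof. by rewrite /scal mpolyCN rmorphN. Qed.

Lemma scalM c d : scal n (c * d) = scal n c * scal n d.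
Proof. by rewrite /scal mpolyCM rmorphM. Qed.

Lemma scalV c : scal n c^-1 = (scal n c)^-1.
Proof.
have [->|c0] := eqVneq c 0; first by rewrite invr0 scal0 invr0.
have s0 : scal n c != 0 by rewrite scal_eq0.
apply: (mulfI s0); rewrite -scalM !divff //.
Qed.

Lemma tofracZ c P : (c *: P)%:F = scal n c * P%:F.
Proof. by rewrite -mul_mpolyC rmorphM. Qed.

End Constants.

(** * Constraint product ratios with a given denominator *)

Section Cone.

Variables (R : realFieldType) (n m : nat) (A : 'M[R]_(m, n.+1)).
Implicit Types (P Q T : {mpoly R[n.+1]}) (f g : ratfun R n) (c : R) (D : nat).

Lemma nonneg_comb0 : nonneg_comb_products A 0.
Proof. by exists [::]; split=> //; rewrite big_nil. Qed.

Lemma nonneg_comb1 : nonneg_comb_products A 1.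
Proof.
exists [:: (1, [::])]; split; last by rewrite big_seq1 /= big_nil scale1r.
by move=> t; rewrite inE => /eqP->; split.
Qed.

Lemma nonneg_comb_constraint P :
  constraint_expr A P -> nonneg_comb_products A P.
Proof.
move=> cP; exists [:: (1, [:: P])]; split.
  by move=> t; rewrite inE => /eqP->; split=> // f; rewrite inE => /eqP->.
by rewrite big_seq1 /= big_seq1 scale1r.
Qed.

Lemma nonneg_combD P Q :
  nonneg_comb_products A P -> nonneg_comb_products A Q ->
  nonneg_comb_products A (P + Q).
Proof.
move=> [s [sP ->]] [t [tP ->]]; exists (s ++ t); split; last by rewrite big_cat.
by move=> u; rewrite mem_cat => /orP[/sP|/tP].
Qed.

Lemma nonneg_combZ c P :
  0 <= c -> nonneg_comb_products A P -> nonneg_comb_products A (c *: P).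
Proof.
move=> c0 [s [sP ->]]; exists [seq (c * t.1, t.2) | t <- s]; split.
  by move=> _ /mapP[t /sP[t0 tP] ->]; split; rewrite ?mulr_ge0.
rewrite big_map scaler_sumr; apply: eq_bigr => t _ /=.
by rewrite scalerA.
Qed.

Lemma nonneg_combM P Q :
  nonneg_comb_products A P -> nonneg_comb_products A Q ->
  nonneg_comb_products A (P * Q).
Proof.
move=> [s [sP ->]] [t [tP ->]].
exists [seq (u.1 * v.1, u.2 ++ v.2) | u <- s, v <- t]; split.
  move=> _ /allpairsP[[u v] /= [/sP[u0 uP] /tP[v0 vP] ->]] /=.
  split; first exact: mulr_ge0.
  by move=> f; rewrite mem_cat => /orP[/uP|/vP].
rewrite big_allpairs_dep big_distrl; apply: eq_bigr => u _ /=.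
rewrite big_distrr; apply: eq_bigr => v _ /=.
by rewrite big_cat -scalerAl -scalerAr scalerA.
Qed.

(** The rational functions [P / Q] with [P] a non-negative combination of
    products of constraint expressions, of total degree at most [D].  For
    fixed [Q] and [D] they form a convex cone. *)
Definition ratio_over Q D f : Prop :=
  exists P, [/\ nonneg_comb_products A P, (total_degree P <= D)%N &
                f = P%:F / Q%:F].

Lemma ratio_overW Q D D' f :
  (D <= D')%N -> ratio_over Q D f -> ratio_over Q D' f.
Proof.
by move=> DD' [P [P0 PD ->]]; exists P; split=> //; apply: leq_trans DD'.
Qed.

Lemma ratio_over0 Q D : ratio_over Q D 0.
Proof.
exists 0; split; first exact: nonneg_comb0.
  by rewrite /total_degree msize0.
by rewrite rmorph0 mul0r.
Qed.

Lemma ratio_overD Q D f g :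
  ratio_over Q D f -> ratio_over Q D g -> ratio_over Q D (f + g).
Proof.
move=> [P [P0 PD ->]] [P' [P'0 P'D ->]]; exists (P + P'); split.
- exact: nonneg_combD.
- exact: total_degreeD.
- by rewrite rmorphD mulrDl.
Qed.

Lemma ratio_overZ Q D c f :
  0 <= c -> ratio_over Q D f -> ratio_over Q D (scal n c * f).
Proof.
move=> c0 [P [P0 PD ->]]; exists (c *: P); split; first exact: nonneg_combZ.
  exact: leq_trans (total_degreeZ _ _) PD.
by rewrite tofracZ mulrA.
Qed.

Lemma ratio_over_sum Q D (I : eqType) (r : seq I) (p : pred I)
    (F : I -> ratfun R n) :
  (forall i, i \in r -> p i -> ratio_over Q D (F i)) ->
  ratio_over Q D (\sum_(i <- r | p i) F i).
Proof.
move=> rF; rewrite big_seq_cond; apply: big_ind => [|f g|i /andP[ri pi]].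
- exact: ratio_over0.
- exact: ratio_overD.
- exact: rF.
Qed.

Lemma ratio_over_linear (i : 'I_m) : ratio_over 1 1 (linear_expr (row i A))%:F.
Proof.
exists (linear_expr (row i A)); split.
- by apply: nonneg_comb_constraint; right; exists i.
- exact: total_degree_linear_expr.
- by rewrite rmorph1 divr1.
Qed.

Lemma ratio_over_var0 : ratio_over 1 1 (var R ord0).
Proof.
exists 'X_ord0; split.
- by apply: nonneg_comb_constraint; left.
- by rewrite /total_degree msizeX mdeg1.
- by rewrite rmorph1 divr1.
Qed.

(** Dividing a product of two members by [T / Q] leads to the denominator
    [Q * T] and not to a multiple of [Q * Q], so the degree of the denominator
    only grows by that of [T]. *)
Lemma ratio_over_mul_div Q T D D' f g : Q != 0 -> T != 0 ->
  ratio_over Q D f -> ratio_over Q D' g ->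
  ratio_over (Q * T) (D + D') (f * g / (T%:F / Q%:F)).
Proof.
move=> Q0 T0 [P [P0 PD ->]] [P' [P'0 P'D ->]]; exists (P * P'); split.
- exact: nonneg_combM.
- by apply: leq_trans (total_degreeM _ _) _; apply: leq_add.
have Qf : Q%:F != 0 by rewrite tofrac_eq0.
have Tf : T%:F != 0 by rewrite tofrac_eq0.
by rewrite !tofracM (mul_div_common _ _ Qf Tf).
Qed.

Lemma ratio_over_expand Q T D D' f : T != 0 ->
  nonneg_comb_products A T -> (total_degree T <= D')%N ->
  ratio_over Q D f -> ratio_over (Q * T) (D + D') f.
Proof.
move=> T0 Tn TD [P [P0 PD ->]]; exists (P * T); split.
- exact: nonneg_combM.
- by apply: leq_trans (total_degreeM _ _) _; apply: leq_add.
have Tf : T%:F != 0 by rewrite tofrac_eq0.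
by rewrite !tofracM -mulf_div (divff Tf) mulr1.
Qed.

End Cone.

(** * The linear forms carried by the generators *)

Section WeightedSum.

Variables (R : realFieldType) (n : nat).
Implicit Types (a b : 'rV[R]_n.+1) (s : seq (generator R n)).

(** The value of the row [a] at the combination of the vectors of [s] weighted
    by their coordinates. *)
Definition weighted_sum a s : ratfun R n :=
  \sum_(g <- s) scal n (slope a g) * g.2.

Lemma slope_comb a (c d : R) (u v : 'cV[R]_n.+1) (f g h : ratfun R n) :
  slope a (c *: u - d *: v, f) = c * slope a (u, g) - d * slope a (v, h).
Proof. by rewrite /slope /= mulmxBr -!scalemxAr !mxE. Qed.

Lemma weighted_sum_sign a b s :
  weighted_sum b s =
    weighted_sum b [seq g <- s | slope a g == 0]
    + weighted_sum b [seq g <- s | 0 < slope a g]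
    + weighted_sum b [seq g <- s | slope a g < 0].
Proof.
rewrite /weighted_sum; elim: s => [|g s IH]; first by rewrite !big_nil !addr0.
by rewrite big_cons IH /=; case: ltgtP => _; rewrite big_cons; ring.
Qed.

Lemma weighted_sum_cons a g s :
  weighted_sum a (g :: s) = scal n (slope a g) * g.2 + weighted_sum a s.
Proof. exact: big_cons. Qed.

Lemma weighted_sum_cat a s t :
  weighted_sum a (s ++ t) = weighted_sum a s + weighted_sum a t.
Proof. exact: big_cat. Qed.

Lemma weighted_sum_init a :
  weighted_sum a (rays (dd_init R n)) + weighted_sum a (lines (dd_init R n)) =
  (linear_expr a)%:F.
Proof.
have sum_unit i : scal n (slope a (unit_col R i, var R i)) * var R i
    = (a 0 i *: 'X_i)%:F.
  by rewrite tofracZ /slope /= /unit_col -colE mxE.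
rewrite /weighted_sum /= big_seq1 big_map big_enum /= /linear_expr.
rewrite big_ord_recl tofracD rmorph_sum sum_unit; congr (_ + _).
by apply: eq_bigr => i _; rewrite sum_unit.
Qed.

(** * Iterations that eliminate a lineality direction *)

(** The pivot splits the lines into those orthogonal to [a], the pivot, and
    the remaining ones; [l] is the pivot with its orientation corrected. *)
Lemma dd_case1P a (s : dd_state R n) : is_case1 a s ->
  exists before l0 after,
    let l : generator R n := if slope a l0 < 0 then (- l0.1, - l0.2) else l0 in
    let update (g : generator R n) : generator R n :=
      (slope a l *: g.1 - slope a g *: l.1, g.2 / scal n (slope a l)) in
    [/\ lines s = before ++ l0 :: after,
        weighted_sum a before = 0,
        slope a l0 != 0 &
        dd_case1 a s =
          DDState ((l.1, l.2 + weighted_sum a after / scal n (slope a l)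
                    + weighted_sum a (rays s) / scal n (slope a l))
                   :: map update (rays s))
                  (before ++ map update after)].
Proof.
move=> case1.
pose xi := find (fun l => slope a l != 0) (lines s).
have xi_lt : (xi < size (lines s))%N by rewrite -has_find.
exists (take xi (lines s)), (nth (0, 0) (lines s) xi), (drop xi.+1 (lines s)).
split.
- by rewrite -drop_nth // cat_take_drop.
- rewrite /weighted_sum (big_nth (0, 0)) big1_seq // => i /=.
  rewrite mem_index_iota size_take xi_lt /= => i_lt.
  have := before_find (0, 0) i_lt; rewrite nth_take // => /negbFE/eqP ->.
  by rewrite scal0 mul0r.
- exact: (nth_find (0, 0) case1).
- by rewrite /weighted_sum !mulr_suml.
Qed.

Lemma weighted_sum_update a b (l : generator R n) s : slope a l != 0 ->
  weighted_sum b
    [seq (slope a l *: g.1 - slope a g *: l.1, g.2 / scal n (slope a l))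
    | g : generator R n <- s] =
  weighted_sum b s
    - scal n (slope b l) / scal n (slope a l) * weighted_sum a s.
Proof.
move=> al0; have {al0} : scal n (slope a l) != 0 by rewrite scal_eq0.
rewrite /weighted_sum big_map mulr_sumr -sumrB => al0.
apply: eq_bigr => g _ /=.
rewrite (slope_comb b _ _ _ _ _ g.2 l.2) -!surjective_pairing scalB !scalM.
exact: eliminate_pivot.
Qed.

(** Reversing a line together with its coordinate does not change its
    contribution. *)
Lemma slope_orient a b (l : generator R n) :
  let l' : generator R n := if slope a l < 0 then (- l.1, - l.2) else l in
  scal n (slope b l') * l'.2 = scal n (slope b l) * l.2.
Proof.
case: ifP => //= _.
by rewrite {1}/slope mulmxN mxE scalN mulrNN.
Qed.

Lemma slope_orient_gt0 a (l : generator R n) : slope a l != 0 ->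
  0 < slope a (if slope a l < 0 then (- l.1, - l.2) else l).
Proof.
case: (ltgtP (slope a l) 0) => // l_lt0 _.
by rewrite {1}/slope mulmxN mxE oppr_gt0.
Qed.

End WeightedSum.

(** * Iterations that cut the cone *)

(** Updating the coordinates of the positive rays and adding the mixed rays
    preserves the sum of the weighted rays: the terms containing both [sb i] and
    [sa j] cancel, and [N] normalizes the weights [mu i * sa i] that multiply the
    [sb j * mu j]. *)
Lemma split_sum (F : fieldType) (I : Type) (pos neg : seq I)
    (sa sb mu : I -> F) :
  let N := \sum_(i <- pos) mu i * sa i in N != 0 ->
  \sum_(i <- pos) sb i * (mu i + \sum_(j <- neg) mu j * mu i * sa j / N)
  + \sum_(i <- pos) \sum_(j <- neg)
      (sa i * sb j - sa j * sb i) * (mu j * mu i / N)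
  = \sum_(i <- pos) sb i * mu i + \sum_(j <- neg) sb j * mu j.
Proof.
move=> N N0; rewrite -big_split /=.
pose Bneg := \sum_(j <- neg) sb j * mu j.
have BnegE : Bneg = N * (Bneg / N) by rewrite mulrC divfK.
rewrite -/Bneg [in RHS]BnegE {1}/N mulr_suml -big_split /=; apply: eq_bigr => i _.
rewrite mulrDr -addrA; congr (_ + _).
rewrite /Bneg mulr_sumr mulr_suml mulr_sumr -big_split /=.
by apply: eq_bigr => j _; rewrite -/N; field.
Qed.

Section Case2.

Variables (R : realFieldType) (n m : nat) (A : 'M[R]_(m, n.+1)).
Implicit Types (a b : 'rV[R]_n.+1) (s : dd_state R n).

Lemma weighted_sum_case2 a b s :
  \sum_(g <- [seq g <- rays s | 0 < slope a g]) g.2 * scal n (slope a g) != 0 ->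
  weighted_sum b (rays (dd_case2 a s)) = weighted_sum b (rays s).
Proof.
move=> N0; rewrite (weighted_sum_sign a b (rays s)) /= !weighted_sum_cat -!addrA.
congr (_ + _); rewrite /weighted_sum big_map big_allpairs_dep /=.
rewrite -(split_sum _ (fun g => scal n (slope b g)) N0); congr (_ + _).
apply: eq_bigr => g _; apply: eq_bigr => h _.
by rewrite (slope_comb b _ _ _ _ _ h.2 g.2) -!surjective_pairing scalB !scalM.
Qed.

Lemma weighted_sum_zero a (r : seq (generator R n)) :
  weighted_sum a [seq g <- r | slope a g == 0] = 0.
Proof.
rewrite /weighted_sum big_filter big1 // => g /eqP ->.
by rewrite scal0 mul0r.
Qed.

(** All the coordinates, and the values of the rows satisfying [B] at the sum of
    the rays of [r] weighted by them, share the denominator [Q]; the numerators have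
    degree at most [D] and [Q] has degree less than [D]. *)
Definition common_denominator (B : 'rV[R]_n.+1 -> Prop) D
    (r : seq (generator R n)) (Q : {mpoly R[n.+1]}) : Prop :=
  [/\ nonneg_comb_products A Q, Q != 0, (total_degree Q < D)%N,
      {in r, forall g, ratio_over A Q D g.2} &
      forall b, B b -> ratio_over A Q D (weighted_sum b r)].

(** The case of a nonzero [N_tot]. *)
Lemma common_denominator_case2_regular (B : 'rV[R]_n.+1 -> Prop) D a s Q :
  B a ->
  \sum_(g <- [seq g <- rays s | 0 < slope a g]) g.2 * scal n (slope a g) != 0 ->
  common_denominator B D (rays s) Q ->
  exists Q', common_denominator B (D + D) (rays (dd_case2 a s)) Q'.
Proof.
move=> Ba N0 [Qn Q0 QD rD BD].
set N := (X in X != 0) in N0.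
have [T [Tn TD NT]] : ratio_over A Q D N.
  rewrite /N big_filter; apply: ratio_over_sum => g gr g0.
  by rewrite mulrC; apply: ratio_overZ (rD _ gr); apply: ltW.
have T0 : T != 0.
  by apply: contraNneq N0 => T0; rewrite NT T0 rmorph0 mul0r.
exists (Q * T); split.
- exact: nonneg_combM.
- exact: mulf_neq0.
- apply: leq_ltn_trans (total_degreeM _ _) _.
  by rewrite -addSn leq_add.
- move=> g; rewrite /= !mem_cat => /or3P[].
  + rewrite mem_filter => /andP[_ gr].
    exact: ratio_over_expand (rD _ gr).
  + move=> /mapP[i + ->] /=; rewrite mem_filter => /andP[_ ir].
    (* the factor of [i.2] is 1 plus the negative part of [S_a] over [N_tot] *)
    have -> : i.2 + \sum_(j <- [seq r <- rays s | slope a r < 0])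
        j.2 * i.2 * scal n (slope a j) / N
        = i.2 * weighted_sum a (rays s) / (T%:F / Q%:F).
      rewrite (weighted_sum_sign a a) weighted_sum_zero add0r -NT mulrDr mulrDl.
      congr (_ + _).
        rewrite [weighted_sum _ _](_ : _ = N) ?mulfK //.
        by apply: eq_bigr => g' _; rewrite mulrC.
      rewrite /weighted_sum mulr_sumr mulr_suml; apply: eq_bigr => j _.
      by rewrite [scal _ _ * _]mulrC mulrA [i.2 * _]mulrC.
    by apply: ratio_over_mul_div => //; [exact: rD|exact: BD].
  + move=> /allpairsP[[i j] /= [+ + ->]] /=.
    rewrite !mem_filter => /andP[_ ir] /andP[_ jr].
    rewrite -/N NT.
    by apply: ratio_over_mul_div => //; exact: rD.
- move=> b Bb; rewrite weighted_sum_case2 //.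
  by apply: ratio_over_expand => //; exact: BD.
Qed.

(** The case [N_tot = 0], where the rays on the negative side are lost. *)
Lemma common_denominator_case2_degenerate (B : 'rV[R]_n.+1 -> Prop) D a s Q :
  B a ->
  \sum_(g <- [seq g <- rays s | 0 < slope a g]) g.2 * scal n (slope a g) = 0 ->
  common_denominator B D (rays s) Q ->
  common_denominator B (D + D) (rays (dd_case2 a s)) Q.
Proof.
move=> Ba N0 [Qn Q0 QD rD BD].
have DD : (D <= D + D)%N by exact: leq_addr.
split=> //; first exact: leq_trans DD.
- move=> g; rewrite /= N0 !mem_cat => /or3P[].
  + rewrite mem_filter => /andP[_ gr].
    exact: ratio_overW (rD _ gr).
  + move=> /mapP[i + ->] /=; rewrite mem_filter => /andP[_ ir].
    rewrite big1 ?addr0; last by move=> j _; rewrite invr0 mulr0.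
    exact: ratio_overW (rD _ ir).
  + move=> /allpairsP[[i j] /= [_ _ ->]] /=.
    by rewrite invr0 mulr0; exact: ratio_over0.
- move=> b Bb; apply: ratio_overW DD _.
  set neg := [seq g <- rays s | slope a g < 0].
  have neg_rays j : j \in neg -> slope a j < 0 /\ j \in rays s.
    by rewrite mem_filter => /andP[].
  (* the value of [a] only comes from the rays about to be discarded *)
  have Wa : weighted_sum a (rays s) = weighted_sum a neg.
    rewrite (weighted_sum_sign a a) weighted_sum_zero add0r.
    rewrite [weighted_sum a [seq g <- _ | 0 < _]](_ : _ = 0) ?add0r //.
    by rewrite -[RHS]N0; apply: eq_bigr => g _; rewrite mulrC.
  have Wb : weighted_sum b (rays (dd_case2 a s)) =
      weighted_sum b (rays s) + \sum_(j <- neg) - (scal n (slope b j) * j.2).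
    rewrite (weighted_sum_sign a b (rays s)) -/neg sumrN addrK /= N0.
    rewrite !weighted_sum_cat; congr (_ + _).
    rewrite -[RHS]addr0 /weighted_sum big_map big_allpairs_dep /=.
    congr (_ + _).
      apply: eq_bigr => i _; rewrite big1 ?addr0 /slope //= => j _.
      by rewrite invr0 mulr0.
    rewrite big1 // => i _; rewrite big1 // => j _.
    by rewrite invr0 !mulr0.
  rewrite Wb; apply: ratio_overD; first exact: BD.
  apply: ratio_over_sum => j jneg _; have [aj jr] := neg_rays j jneg.
  have [bj|bj] := leP (slope b j) 0.
    by rewrite -mulNr -scalN; apply: ratio_overZ (rD _ jr); rewrite oppr_ge0.
  have -> : - (scal n (slope b j) * j.2) =
      scal n (slope b j / - slope a j) * (scal n (slope a j) * j.2).
    rewrite mulrA -scalM invrN mulrN mulNr -mulrA mulVf ?mulr1 ?lt_eqF //.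
    by rewrite scalN mulNr.
  apply: ratio_overZ; first by rewrite ltW // divr_gt0 ?oppr_gt0.
  (* isolate the term of [j] in the value of [a]: the other slopes are negative *)
  have -> : scal n (slope a j) * j.2 = weighted_sum a (rays s) +
      \sum_(i <- rem j neg) - (scal n (slope a i) * i.2).
    by rewrite Wa /weighted_sum (big_rem _ jneg) /= sumrN addrK.
  apply: ratio_overD; first exact: BD.
  apply: ratio_over_sum => i /mem_rem/neg_rays[ai ir] _.
  rewrite -mulNr -scalN; apply: ratio_overZ (rD _ ir).
  by rewrite oppr_ge0 ltW.
Qed.

End Case2.

(** * The two phases of a run *)

Section Run.

Variables (R : realFieldType) (n m : nat) (A : 'M[R]_(m, n.+1)).

(** The generators, weighted by their coordinates, add up to the generic point
    [(x_0; x)], tested against every row vector; the coordinates of the rays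
    have degree at most 1 and denominator 1. *)
Definition first_phase (s : dd_state R n) : Prop :=
  {in rays s, forall g, ratio_over A 1 1 g.2} /\
  forall b, weighted_sum b (rays s) + weighted_sum b (lines s)
            = (linear_expr b)%:F.

Lemma first_phase_init : first_phase (dd_init R n).
Proof.
split; last exact: weighted_sum_init.
by move=> g; rewrite inE => /eqP ->; exact: ratio_over_var0.
Qed.

Lemma first_phase_case1 (i : 'I_m) (s : dd_state R n) :
  is_case1 (row i A) s -> first_phase s ->
  first_phase (dd_case1 (row i A) s).
Proof.
set a := row i A => case1 [rD xE].
have [before [l0 [after]]] := dd_case1P case1.
set l := if _ then _ else _ => /= -[linesE before0 l0_neq0 ->].
have al_gt0 : 0 < slope a l by exact: slope_orient_gt0.
have al_neq0 : slope a l != 0 by rewrite gt_eqF.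
have lE b : scal n (slope b l) * l.2 = scal n (slope b l0) * l0.2.
  exact: slope_orient.
have scal_neq0 : scal n (slope a l) != 0 by rewrite scal_eq0.
split=> [g | b] /=.
- rewrite inE => /orP[/eqP -> | /mapP[h hr ->]] /=; last first.
    by rewrite mulrC -scalV; apply: ratio_overZ (rD _ hr); rewrite invr_ge0 ltW.
  (* the new coordinate is the constraint [a] divided by the pivot slope *)
  rewrite (_ : _ + _ = scal n (slope a l)^-1 * (linear_expr a)%:F).
    by apply: ratio_overZ (ratio_over_linear _ _); rewrite invr_ge0 ltW.
  rewrite -xE linesE weighted_sum_cat weighted_sum_cons before0 add0r -lE.
  by rewrite scalV; exact: pivot_coordinate.
- rewrite -xE linesE weighted_sum_cons !weighted_sum_cat weighted_sum_cons.
  by rewrite !weighted_sum_update //= -lE; exact: pivot_identity.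
Qed.

(** No remaining row triggers an elimination, and the rays satisfy the
    common-denominator property for the remaining rows. *)
Definition second_phase (k : nat) : Prop :=
  (forall j : 'I_m, (k <= j)%N -> ~~ is_case1 (row j A) (dd_run A k)) /\
  exists Q, common_denominator A
    (fun b => exists2 j : 'I_m, (k <= j)%N & b = row j A)
    (2 ^ dd_num_case2 A k) (rays (dd_run A k)) Q.

Lemma dd_runS (k : 'I_m) : dd_run A k.+1 = dd_step (dd_run A k) (row k A).
Proof.
have km : (k < size [seq row i A | i <- enum 'I_m])%N.
  by rewrite size_map size_enum_ord.
rewrite /dd_run (take_nth 0 km) foldl_rcons (nth_map k) ?size_enum_ord //.
by rewrite nth_ord_enum.
Qed.

Lemma dd_num_case20 : dd_num_case2 A 0 = 0%N.
Proof. by rewrite /dd_num_case2 eq_card0 // => i; rewrite inE. Qed.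

Lemma dd_num_case2S (k : 'I_m) :
  dd_num_case2 A k.+1 =
    (dd_num_case2 A k + ~~ is_case1 (row k A) (dd_run A k))%N.
Proof.
rewrite /dd_num_case2; case: (boolP (is_case1 _ _)) => case1k /=.
  rewrite addn0; apply: eq_card => i; rewrite !inE ltnS leq_eqVlt.
  by case: eqVneq => //= /val_inj ->; rewrite case1k ltnn.
rewrite addn1 (cardsD1 k) inE ltnSn case1k add1n; congr _.+1.
apply: eq_card => i; rewrite !inE ltnS [in RHS]ltn_neqAle -val_eqE /=.
by rewrite andbA.
Qed.

Lemma weighted_sum_orthogonal (a : 'rV[R]_n.+1) (s : dd_state R n) :
  ~~ is_case1 a s -> weighted_sum a (lines s) = 0.
Proof.
move=> /hasPn ortho; rewrite /weighted_sum big1_seq // => l /ortho.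
by rewrite negbK => /eqP ->; rewrite scal0 mul0r.
Qed.

Lemma first_second_phase (k : 'I_m) :
  two_phase A -> ~~ is_case1 (row k A) (dd_run A k) ->
  dd_num_case2 A k = 0%N -> first_phase (dd_run A k) -> second_phase k.
Proof.
move=> A_ordered case2k num0 [rD xE].
have case2 (j : 'I_m) : (k <= j)%N -> ~~ is_case1 (row j A) (dd_run A k).
  by move=> kj; apply: contra case2k => case1j; apply: A_ordered; exists j.
split=> //; exists 1; rewrite num0; split=> //.
- exact: nonneg_comb1.
- exact: oner_neq0.
- by rewrite total_degree1.
- move=> _ [j kj ->].
  rewrite -[weighted_sum _ _]addr0 -(weighted_sum_orthogonal (case2 j kj)) xE.
  exact: ratio_over_linear.
Qed.

Lemma second_phaseS (k : 'I_m) : second_phase k -> second_phase k.+1.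
Proof.
move=> [case2 [Q invQ]]; have case2k := case2 k (leqnn k).
rewrite /second_phase dd_num_case2S case2k addn1 dd_runS /dd_step.
rewrite (negbTE case2k); split=> [j kj|]; first exact: case2 j (ltnW kj).
have rowk : exists2 j : 'I_m, (k <= j)%N & row k A = row j A by exists k.
have [Q' [? ? ? ? BD]] : exists Q', common_denominator A
    (fun b => exists2 j : 'I_m, (k <= j)%N & b = row j A)
    (2 ^ dd_num_case2 A k + 2 ^ dd_num_case2 A k)
    (rays (dd_case2 (row k A) (dd_run A k))) Q'.
  have [N0|N0] := eqVneq (\sum_(g <- [seq g <- rays (dd_run A k) |
      0 < slope (row k A) g]) g.2 * scal n (slope (row k A) g)) 0.
    by exists Q; apply: common_denominator_case2_degenerate.
  exact: common_denominator_case2_regular N0 invQ.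
exists Q'; rewrite expnS mul2n -addnn; split=> // _ [j kj ->].
by apply: BD; exists j => //; exact: ltnW.
Qed.

Lemma phase_dichotomy (k : nat) : two_phase A -> (k <= m)%N ->
  (dd_num_case2 A k = 0%N /\ first_phase (dd_run A k)) \/ second_phase k.
Proof.
move=> A_ordered; elim: k => [_|k IH k_lt_m].
  left; split; first exact: dd_num_case20.
  by rewrite /dd_run take0; exact: first_phase_init.
have [[num0 fk]|sk] := IH (ltnW k_lt_m); last first.
  by right; exact: (second_phaseS (k := Ordinal k_lt_m)).
have [case1k|case2k] := boolP (is_case1 (row (Ordinal k_lt_m) A) (dd_run A k)).
  left; rewrite (dd_num_case2S (Ordinal k_lt_m)) (dd_runS (Ordinal k_lt_m)).
  by rewrite /dd_step /= case1k num0; split=> //; exact: first_phase_case1.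
right; apply: (second_phaseS (k := Ordinal k_lt_m)).
exact: first_second_phase.
Qed.

(** Each execution of Case 2 at most doubles the bound: after [i] of them the
    numerators have degree at most [2 ^ i] and the denominators at most
    [2 ^ i - 1]. *)
Lemma dd_mu_repr (k : nat) (f : ratfun R n) : two_phase A -> (k <= m)%N ->
  f \in dd_mu A k ->
  exists P Q, [/\ constraint_product_repr A f P Q,
    (total_degree P <= 2 ^ dd_num_case2 A k)%N &
    (total_degree Q < 2 ^ dd_num_case2 A k)%N].
Proof.
move=> A_ordered k_le_m /mapP[g gr ->].
case: (phase_dichotomy A_ordered k_le_m) => [[-> [rD _]]|].
  have [P [Pn PD gE]] := rD _ gr.
  exists P, 1; split=> //; last by rewrite total_degree1.
  by split=> //; [exact: nonneg_comb1|exact: oner_neq0].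
move=> [_ [Q [Qn Q0 QD rD _]]]; have [P [Pn PD gE]] := rD _ gr.
by exists P, Q.
Qed.

End Run.

Lemma expn2_le_expn3 i : (2 * 2 ^ i <= 3 ^ i + 1)%N.
Proof.
elim: i => // i; rewrite !expnS.
have : (0 < 3 ^ i)%N by rewrite expn_gt0.
lia.
Qed.

Theorem proposition8 (R : realFieldType) (n m : nat) (A : 'M[R]_(m, n.+1))
    (A_ordered : two_phase A) (k : nat) (k_le_m : (k <= m)%N)
    (j : nat) (j_lt_p : (j < size (dd_mu A k))%N) :
  constraint_product_ratio A (dd_mu A k)`_j /\
  forall i : nat, dd_num_case2 A k = i ->
    exists num den : {mpoly R[n.+1]},
      [/\ constraint_product_repr A (dd_mu A k)`_j num den,
          (total_degree num)%:R <= 3%:R ^+ i / 2%:R + 1 / 2%:R :> R &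
          (total_degree den)%:R <= 3%:R ^+ i / 2%:R - 1 / 2%:R :> R].
Proof.
have [P [Q [PQ PD QD]]] := dd_mu_repr A_ordered k_le_m (mem_nth 0 j_lt_p).
split=> [|i iE]; first by exists P, Q.
exists P, Q; rewrite iE in PD QD; have le23 := expn2_le_expn3 i.
have P2 : (2 * total_degree P <= 3 ^ i + 1)%N.
  by apply: leq_trans le23; rewrite leq_mul2l.
have Q2 : (2 * total_degree Q + 1 <= 3 ^ i)%N.
  have : (2 * (total_degree Q).+1 <= 3 ^ i + 1)%N.
    by apply: leq_trans le23; rewrite leq_mul2l.
  by rewrite mulnS; lia.
split=> //.
- by move: P2; rewrite -(ler_nat R) natrM natrD natrX; lra.
- by move: Q2; rewrite -(ler_nat R) natrD natrM natrX; lra.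
Qed.
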